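(* If $a=\{a_j\}_{j\ge1}$ is any positive, summable, decreasing sequence and $E\in\mathcal{C}_a$ is any complementary set, then $\dim_A E\le\dim_A D_a$.
   Context: Decreasing means $a_j\ge a_{j+1}$ for all $j$. Let $L=\sum_j a_j$. The family $\mathcal{C}_a$ of complementary sets of $a$ consists of the closed subsets $E$ of $[0,L]$ of the form $E=[0,L]\setminus\bigcup_{j=1}^\infty U_j$, where $\{U_j\}$ is a disjoint family of open intervals contained in $[0,L]$ with the length of $U_j$ equal to $a_j$ for each $j$. The decreasing rearrangement is the countable set $D_a=\{0\}\cup\{\sum_{i=k}^\infty a_i: k\ge 1\}\in\mathcal{C}_a$. For non-empty $F\subset\mathbb{R}$, $N_r(F)$ denotes the minimum number of closed balls of radius $r$ needed to cover $F$, and $B(x,R)$ is the closed ball of radius $R$ centred at $x$. The Assouad dimension is $$\dim_A F=\inf\Bigl\{\alpha:\ \exists\, c,\rho>0 \text{ such that } \sup_{x\in F}N_r(B(x,R)\cap F)\le c\left(\tfrac{R}{r}\right)^{\alpha}\text{ for all }0<r<R<\rho\Bigr\}.$$ *)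

(* Defs.v *)
From HB Require Import structures.
From mathcomp Require Import all_boot all_order all_algebra.
From mathcomp Require Import all_classical all_reals all_analysis.

Set Implicit Arguments.
Unset Strict Implicit.
Unset Printing Implicit Defensive.

Import Order.TTheory GRing.Theory Num.Theory.
Import numFieldNormedType.Exports.

Local Open Scope classical_set_scope.
Local Open Scope ring_scope.

(* Sequences are indexed from 0: the term a_j (j >= 1) of the usual numbering
   is a (j - 1) here. *)

Definition total_length (R : realType) (a : nat -> R) : R :=
  limn (series a).

(* The class C_a.  With a j > 0 every gap `]l j, u j[ is a genuine interval. *)
Definition complementary_sets (R : realType) (a : nat -> R) : set (set R) :=
  [set E | closed E /\
    exists l u : nat -> R,
      [/\ forall j, u j - l j = a j,
          forall j, `]l j, u j[ `<=` `[0, total_length a],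
          trivIset setT (fun j => `]l j, u j[%classic)
        & E = `[0, total_length a] `\` \bigcup_j `]l j, u j[%classic]].

Definition decreasing_rearrangement (R : realType) (a : nat -> R) : set R :=
  [set 0] `|` range (fun k : nat => limn (fun n : nat => \sum_(k <= i < n) a i)).

(* N_r(F).  Centres may lie outside F; the value is +oo if no finite cover
   exists, and otherwise the infimum is attained. *)
Definition covering_number (R : realType) (r : R) (F : set R) : \bar R :=
  ereal_inf [set (n%:R)%:E | n in [set n : nat |
    exists c : 'I_n -> R, F `<=` \bigcup_(i in setT) closed_ball (c i) r]].

(* The infimum is taken in the extended reals, hence +oo if no exponent is
   admissible. *)
Definition assouad_dim (R : realType) (F : set R) : \bar R :=
  ereal_inf [set alpha%:E | alpha in [set alpha : R |
    exists c rho : R, [/\ 0 < c, 0 < rho &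
      forall r s : R, 0 < r -> r < s -> s < rho ->
        (ereal_sup [set covering_number r (closed_ball x s `&` F) | x in F]
          <= (c * (s / r) `^ alpha)%:E)%E]]].

(* Main.v *)
Require Import Defs.
From mathcomp Require Import all_boot all_order all_algebra.
From mathcomp Require Import all_classical all_reals all_analysis.
From mathcomp Require Import lra zify.

Set Implicit Arguments.
Unset Strict Implicit.
Unset Printing Implicit Defensive.

Import Order.TTheory GRing.Theory Num.Theory.
Import numFieldNormedType.Exports.

Local Open Scope classical_set_scope.
Local Open Scope ring_scope.

(** The theorem follows from a bound on covering numbers at each pair of scales:
    if [0 < r < s] and every ball of radius [6 s] centred in [D_a] meets [D_a]
    in a set that [M] balls of radius [r] cover, then every ball of radius [s]
    meets [E] in a set that [9 M] balls of radius [r] cover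
    ([covering_complementary_le]). Hence an exponent admissible for [D_a], with
    constants [c] and [rho], is admissible for [E], with constants
    [9 c 6 ^ alpha] and [rho / 6].

    For that bound, call a gap large if it is longer than [2 r]. As [a]
    decreases, the large gaps are those of index [< n] for some [n]; write
    [T_k] for the tail sum of [a] from [k] on. Cut the line into cells of length
    [2 r] and count those that meet [E] within the ball ([covering_off_gaps]).

    - The cells that contain an endpoint of a large gap: all but at most two of
      these gaps lie in one interval of length [2 s + 4 r <= 6 s]. If [m] large
      gaps lie there, then the [m] shortest large gaps have total length at most
      [6 s], so [T_(n-m), ..., T_n] lie in one ball of radius [6 s]; as they are
      more than [2 r] apart, [m + 1 <= M] ([large_gaps_le_covering]).

    - Any other cell that meets [E] is disjoint from all large gaps. These cells
      fit in the length [T_n] that the large gaps leave, and in that of the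
      ball, up to the cells at the rim, so their number is controlled by
      [min (T_n, 2 s) / (2 r)]. But [D_a] has no large gap below [T_n], so its
      part in [[0, min (T_n, 2 s)]] needs as many balls, up to a constant
      ([tail_length_le_covering]).

    In both cases only the lengths of the gaps of [E] enter, and [D_a] is extremal
    because it puts the shortest large gaps side by side, and all the others next
    to [0]. *)

(** * Covering numbers, packings and grids *)

Lemma packing_le_covering (R : realType) (r : R) (F : set R) (K : nat)
    (f : 'I_K -> R) : 0 < r -> (forall i, F (f i)) ->
    (forall i j : 'I_K, (i < j)%N -> 2 * r < `|f i - f j|) ->
  ((K%:R)%:E <= covering_number r F)%E.
Proof.
move=> r0 fF fsep; apply: le_ereal_inf_tmp => _ [n [c cF] <-].
rewrite lee_fin ler_nat.
have /choice[g gP] : forall i, exists k : 'I_n, `|c k - f i| <= r.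
  move=> i; have [k _] := cF _ (fF i).
  by rewrite closed_ballE// => ck; exists k.
have far (i j : 'I_K) : (i < j)%N -> g i != g j.
  move=> ij; apply/eqP => gij; have := fsep _ _ ij; apply/negP; rewrite -leNgt.
  have -> : f i - f j = (c (g i) - f j) - (c (g i) - f i) by lra.
  apply: (le_trans (ler_normB _ _)); have := gP i; have := gP j.
  rewrite -gij; lra.
suff /leq_card : injective g by rewrite !card_ord.
move=> i j gij; have [/far|/far|/val_inj//] := ltngtP i j.
- by rewrite gij eqxx.
- by rewrite gij eqxx.
Qed.

Lemma covering_le_cells (R : realType) (r : R) (F : set R) (K : nat)
    (C : {set 'I_K}) : 0 < r ->
    (forall e, F e -> exists2 k, k \in C &
       k%:R * (2 * r) <= e < k.+1%:R * (2 * r)) ->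
  (covering_number r F <= (#|C|%:R)%:E)%E.
Proof.
move=> r0 FC; apply: ereal_inf_lbound; exists #|C| => //=.
exists (fun i : 'I_#|C| => (val (enum_val i))%:R * (2 * r) + r) => e Fe.
have [k kC /andP[ke ek]] := FC _ Fe.
exists (enum_rank_in kC k) => //; rewrite closed_ballE//=/closed_ball_/=.
rewrite enum_rankK_in// ler_norml; move: ek; rewrite -natr1; lra.
Qed.

(** * Families of disjoint intervals *)

(** The interval with the largest right endpoint has all the others to its left;
    remove it and shrink [q] to its left endpoint. *)
Lemma sum_disjoint_itv (R : realDomainType) (I : finType) (A : {set I})
    (l u : I -> R) (p q : R) : p <= q ->
    (forall i, i \in A -> [/\ p <= l i, l i < u i & u i <= q]) ->
    {in A &, forall i j, i != j -> u i <= l j \/ u j <= l i} ->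
  \sum_(i in A) (u i - l i) <= q - p.
Proof.
have [n] := ubnP #|A|; elim: n => // n IH in A q *.
rewrite ltnS => cA pq inA dis.
have [->|[i0 i0A]] := set_0Vmem A; first by rewrite big_set0 subr_ge0.
have [i iA imax] := @arg_maxP _ R I i0 (mem A) u i0A.
have {}iA : i \in A by [].
rewrite (big_setD1 i)//=.
have [pi lui uiq] := inA i iA.
suff : \sum_(j in A :\ i) (u j - l j) <= l i - p by lra.
apply: IH => //.
- by apply: leq_trans cA; rewrite (cardsD1 i A) iA.
- move=> j /setD1P[ji jA]; have [pj luj ujq] := inA j jA; split => //.
  have [//|uilj] := dis _ _ jA iA ji.
  by have := imax j jA; rewrite /Order.ge/= => uji; lra.
- by move=> j k /setD1P[_ jA] /setD1P[_ kA]; exact: dis.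
Qed.

(** The last terms of a decreasing sequence are its smallest ones, so no choice
    of equally many indices below [n] gives a smaller sum. *)
Lemma sum_last_le (R : numDomainType) (a : nat -> R) n (S : {set 'I_n}) :
    (forall j, a j.+1 <= a j) ->
  \sum_(n - #|S| <= i < n) a i <= \sum_(i in S) a i.
Proof.
move=> a_dec.
(* A set of ordinals cannot be restricted along an induction on [n]; a predicate
   on [nat] can. *)
have gen (P : pred nat) : let m := (\sum_(0 <= i < n) P i)%N in
    (m <= n)%N /\
    \sum_(n - m <= i < n) a i <= \sum_(0 <= i < n) if P i then a i else 0.
  elim: n {S} => [|n [mn IH]]; first by rewrite /= !big_geq.
  rewrite !big_nat_recr//=; case: (P n).
    rewrite addn1 subSS ltnS; split => //.
    by rewrite big_nat_recr ?leq_subr//= lerD2r.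
  rewrite addn0 addr0 subSn//; split; first exact: leqW.
  apply: le_trans IH; rewrite big_add1/=; exact: ler_sum.
pose P k := [exists i : 'I_n, (i == k :> nat) && (i \in S)].
have PE (i : 'I_n) : P i = (i \in S).
  apply/existsP/idP => [[j /andP[/eqP/val_inj-> //]]|iS].
  by exists i; rewrite eqxx.
have [_] := gen P; rewrite !big_mkord.
have -> : (\sum_(i < n) P i)%N = #|S|.
  rewrite -sum1_card [RHS]big_mkcond/=; apply: eq_bigr => i _.
  by rewrite PE; case: (i \in S).
move=> /le_trans; apply; rewrite [leRHS]big_mkcond/=.
by apply: ler_sum => i _; rewrite PE.
Qed.

(** Otherwise the midpoint of the larger left and the smaller right endpoint is a
    common point. *)
Lemma disjoint_itv_ordered (R : realFieldType) (l u l' u' : R) :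
    l < u -> l' < u' -> `]l, u[%classic `&` `]l', u'[%classic = set0 ->
  u <= l' \/ u' <= l.
Proof.
move=> lu lu' dis; have [|ul'] := leP u l'; first by left.
have [|u'l] := leP u' l; first by right.
suff : (set0 : set R) ((Num.max l l' + Num.min u u') / 2) by [].
rewrite -dis; split; rewrite /= in_itv/= maxEle minEle; do 2 case: ifP; lra.
Qed.

Lemma itv_subset_bounds (R : realFieldType) (l u p q : R) :
  l < u -> `]l, u[ `<=` `[p, q] -> p <= l /\ u <= q.
Proof.
move=> lu sub; split; rewrite leNgt; apply/negP => H.
  have := sub ((l + Num.min u p) / 2); rewrite /= !in_itv/= minEle.
  by case: ifP => up; move=> /(_ ltac:(lra)); lra.
have := sub ((u + Num.max l q) / 2); rewrite /= !in_itv/= maxEle.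
by case: ifP => up; move=> /(_ ltac:(lra)); lra.
Qed.

(** * Covering numbers of the decreasing rearrangement *)

Definition tail_sum (R : realType) (a : nat -> R) (k : nat) : R :=
  limn (fun n : nat => \sum_(k <= i < n) a i).

Lemma tail_sumE (R : realType) (a : nat -> R) k : cvgn (series a) ->
  tail_sum a k = total_length a - series a k.
Proof.
move=> ca; apply: cvg_lim => //.
have : (fun n => series a n - series a k) @ \oo --> total_length a - series a k.
  by apply: cvgB => //; exact: cvg_cst.
apply: cvg_trans; apply: near_eq_cvg; near=> n.
rewrite /series/= (@big_cat_nat _ _ _ k 0 n)//=; first lra.
by near: n; exact: nbhs_infty_ge.
Unshelve. all: by end_near. Qed.

Lemma tail_sumB (R : realType) (a : nat -> R) k n : cvgn (series a) ->
  (k <= n)%N -> tail_sum a k - tail_sum a n = \sum_(k <= i < n) a i.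
Proof.
move=> ca kn; rewrite !tail_sumE// /series/= (@big_cat_nat _ _ _ k 0 n)//=; lra.
Qed.

Lemma tail_sum_ge0 (R : realType) (a : nat -> R) k : (forall j, 0 < a j) ->
  cvgn (series a) -> 0 <= tail_sum a k.
Proof.
move=> a0 ca; rewrite tail_sumE// subr_ge0; apply: nondecreasing_cvgn_le => //.
by apply: nondecreasing_series => i _ _; exact: ltW.
Qed.

Lemma le_tail_sum (R : realType) (a : nat -> R) k n : (forall j, 0 < a j) ->
  cvgn (series a) -> (k <= n)%N -> tail_sum a n <= tail_sum a k.
Proof.
move=> a0 ca kn; rewrite -subr_ge0 tail_sumB//.
by apply: sumr_ge0 => i _; exact: ltW.
Qed.

Lemma tail_sum_lt (R : realType) (a : nat -> R) e : cvgn (series a) ->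
  0 < e -> exists k, tail_sum a k < e.
Proof.
move=> ca e0; have /cvgrPdist_lt/(_ e e0)[k _ /(_ k (leqnn k))] := ca.
move=> /(le_lt_trans (ler_norm _)) H; exists k; by rewrite tail_sumE.
Qed.

Lemma tail_sum_in (R : realType) (a : nat -> R) k :
  decreasing_rearrangement a (tail_sum a k).
Proof. by right; exists k. Qed.

(** The last [#|S|] gaps before index [n] are consecutive in the decreasing
    rearrangement and together no longer than those of [S]. Their [#|S| + 1]
    endpoints thus lie within [t] of the rightmost and are pairwise more than
    [2 r] apart, so that no ball of radius [r] contains two of them. *)
Lemma large_gaps_le_covering (R : realType) (a : nat -> R) (r t M : R) n
    (S : {set 'I_n}) :
    (forall j, 0 < a j) -> cvgn (series a) -> (forall j, a j.+1 <= a j) ->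
    0 < r -> 0 < t ->
    (forall y, decreasing_rearrangement a y ->
      (covering_number r (closed_ball y t `&` decreasing_rearrangement a)
        <= M%:E)%E) ->
    (forall j, (j < n)%N -> 2 * r < a j) -> \sum_(j in S) a j <= t ->
  #|S|%:R + 1 <= M.
Proof.
move=> a0 ca a_dec r0 t0 HM large St.
have Sn : (#|S| <= n)%N by rewrite -[n in leqRHS]card_ord max_card.
have -> : #|S|%:R + 1 = #|S|.+1%:R :> R by rewrite natr1.
rewrite -lee_fin; apply: le_trans (HM _ (tail_sum_in a n)).
apply: (@packing_le_covering _ _ _ _
  (fun i : 'I_(#|S|.+1) => tail_sum a (n - #|S| + i))) => //.
  move=> i; split; last exact: tail_sum_in.
  have iS : (n - #|S| + i <= n)%N by have := ltn_ord i; lia.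
  rewrite closed_ballE// /closed_ball_/= distrC.
  rewrite ger0_norm ?subr_ge0 ?le_tail_sum//.
  apply: le_trans St; apply: le_trans (sum_last_le _ a_dec).
  by rewrite -tail_sumB ?leq_subr// lerD2r le_tail_sum// leq_addr.
move=> i j ij; rewrite ger0_norm; last first.
  by rewrite subr_ge0 le_tail_sum// leq_add2l ltnW.
have iS : (n - #|S| + i < n)%N by have := ltn_ord i; have := ltn_ord j; lia.
apply: (lt_le_trans (large _ iS)).
have <- : tail_sum a (n - #|S| + i) - tail_sum a (n - #|S| + i).+1
          = a (n - #|S| + i)%N by rewrite tail_sumB// big_nat1.
by rewrite lerD2l lerN2 le_tail_sum// -addnS leq_add2l.
Qed.

(** The largest tail sum that is at most [y] works: the next larger one exceeds it
    by a single gap of index at least [n]. *)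
Lemma small_gaps_dense (R : realType) (a : nat -> R) (h y : R) n :
    (forall j, 0 < a j) -> cvgn (series a) ->
    0 <= h -> (forall j, (n <= j)%N -> a j <= h) -> 0 <= y <= tail_sum a n ->
  exists2 d, decreasing_rearrangement a d & 0 <= d /\ y - h <= d <= y.
Proof.
move=> a0 ca h0 small /andP[]; rewrite le_eqVlt => /predU1P[<-|y0] yn.
  by exists 0; [left|lra].
have ex : exists k, tail_sum a k <= y.
  by have [k /ltW] := tail_sum_lt ca y0; exists k.
case: (ex_minnP ex) => k ky kmin.
exists (tail_sum a k); first exact: tail_sum_in.
rewrite ky andbT; split; first exact: tail_sum_ge0.
have [kn|] := leqP k n; first by have := le_tail_sum a0 ca kn; lra.
case: k ky kmin => // k ky kmin nk.
have : y < tail_sum a k by rewrite ltNge; apply/negP => /kmin; rewrite ltnn.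
have := tail_sumB ca (leqnSn k); rewrite big_nat1; have := small k nk; lra.
Qed.

(** Points spaced by [5 r] along [[0, b]] can be moved down by at most [2 r] into
    the decreasing rearrangement, and they remain at least [3 r] apart: a packing
    of more than [b / (5 r)] points. *)
Lemma tail_length_le_covering (R : realType) (a : nat -> R) (r t b M : R) n :
    (forall j, 0 < a j) -> cvgn (series a) -> 0 < r -> 0 < t ->
    (forall y, decreasing_rearrangement a y ->
      (covering_number r (closed_ball y t `&` decreasing_rearrangement a)
        <= M%:E)%E) ->
    (forall j, (n <= j)%N -> a j <= 2 * r) ->
    0 <= b <= tail_sum a n -> b <= t ->
  b <= 5 * r * M.
Proof.
move=> a0 ca r0 t0 HM small /andP[b0 bn] bt.
have r5 : 0 < 5 * r by lra.
pose K := Num.truncn (b / (5 * r)).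
have /andP[Kb bK] : K%:R <= b / (5 * r) < K.+1%:R.
  by apply: truncn_itv; apply: divr_ge0 => //; exact: ltW.
suff : K.+1%:R <= M.
  move=> KM; have := lt_le_trans bK KM; rewrite ltr_pdivrMr//; lra.
have /choice[d dP] : forall i : 'I_K.+1, exists d,
    decreasing_rearrangement a d /\ (0 <= d /\
       i%:R * (5 * r) - 2 * r <= d <= i%:R * (5 * r) /\
       i%:R * (5 * r) <= b).
  move=> i; have ib : i%:R * (5 * r) <= b.
    rewrite -ler_pdivlMr//; apply: le_trans Kb; rewrite ler_nat.
    by have := ltn_ord i.
  have i0 : (0 : R) <= i%:R * (5 * r) by rewrite mulr_ge0// ltW.
  have [||d Dd dy] :=
    @small_gaps_dense _ a (2 * r) (i%:R * (5 * r)) n a0 ca _ small.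
  - lra.
  - lra.
  by exists d; split => //; lra.
rewrite -lee_fin; apply: le_trans (HM 0 _); last by left.
apply: (@packing_le_covering _ _ _ _ d) => //.
  move=> i; have [Dd di] := dP i; split => //.
  by rewrite closed_ballE// /closed_ball_/= sub0r normrN ger0_norm; lra.
move=> i j ij; have [_ di] := dP i; have [_ dj] := dP j.
have : i%:R + 1 <= j%:R :> R by rewrite natr1 ler_nat.
rewrite -(ler_pM2r r5) => ijr.
rewrite distrC; apply: lt_le_trans (ler_norm _); lra.
Qed.

(** * Covering a set that avoids finitely many gaps *)

Lemma gap_at_unique (R : realDomainType) n (l u : 'I_n -> R) (z : R) :
    (forall i j, i != j -> u i <= l j \/ u j <= l i) ->
  (#|[set j | (l j < z < u j)%R]%SET| <= 1)%N.
Proof.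
move=> ord; have [->|[i]] := set_0Vmem [set j | (l j < z < u j)%R]%SET.
  by rewrite cards0.
rewrite inE => iz; rewrite -(cards1 i); apply: subset_leq_card.
apply/fintype.subsetP => j; rewrite !inE => jz; have [//|ji] := eqVneq j i.
have := ord _ _ ji; lra.
Qed.

(** A gap that has an endpoint strictly inside [[p, q]] but is not contained in it
    contains [p] or [q], and disjointness leaves at most one gap around each.
    Strictness matters: a gap that touches [p] or [q] from outside contains
    neither. *)
Lemma card_gaps_with_end_in (R : realDomainType) n (l u : 'I_n -> R) (p q : R) :
    (forall j, l j < u j) ->
    (forall i j, i != j -> u i <= l j \/ u j <= l i) ->
  (#|[set j | (p < l j < q)%R || (p < u j < q)%R]%SET|
     <= #|[set j | (p <= l j)%R && (u j <= q)%R]%SET| + 2)%N.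
Proof.
move=> lu ord.
have sub : ([set j | (p < l j < q)%R || (p < u j < q)%R] \subset
    [set j | (p <= l j)%R && (u j <= q)%R] :|:
    ([set j | (l j < p < u j)%R] :|: [set j | (l j < q < u j)%R]))%SET.
  apply/fintype.subsetP => j; rewrite !inE; have := lu j.
  by have [] := leP p (l j); have [] := leP (u j) q; rewrite ?orbT//= => *; lra.
apply: (leq_trans (subset_leq_card sub)).
apply: (leq_trans (leq_card_setU _ _)).
rewrite leq_add2l; apply: (leq_trans (leq_card_setU _ _)).
by rewrite -[2%N]/(1 + 1)%N leq_add ?gap_at_unique.
Qed.

(** Here [g] is the number of grid cells of length [2 r] that meet [F] in the ball
    and contain no endpoint of a gap. Such a cell is disjoint from every gap, as
    otherwise the gap would contain it, including its point of [F]. So the two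
    length bounds are those of disjoint families: these cells in the ball widened
    by one cell on each side, and these cells together with the gaps in [[0, L]]
    widened by the last cell. The other cells are charged to the gap endpoints
    that they contain. *)
Lemma covering_off_gaps (R : realType) (r s x L : R) n (l u : 'I_n -> R)
    (F : set R) :
    0 < r -> 0 < s -> 0 <= L ->
    (forall j, [/\ 0 <= l j, l j < u j & u j <= L]) ->
    (forall i j, i != j -> u i <= l j \/ u j <= l i) ->
    (forall e, F e -> 0 <= e <= L /\ forall j, e <= l j \/ u j <= e) ->
  exists g : nat,
    [/\ g%:R * (2 * r) <= 2 * s + 4 * r,
        \sum_(j < n) (u j - l j) + g%:R * (2 * r) <= L + 2 * r &
        (covering_number r (closed_ball x s `&` F) <=
         ((g + (2 * (#|[set j | (x - s - 2 * r <= l j)%R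
            && (u j <= x + s + 2 * r)%R]%SET| + 2)))%:R)%:E)%E].
Proof.
move=> r0 s0 L0 lu ord FP.
set d := 2 * r; have d0 : 0 < d by rewrite /d; lra.
set p := x - s - d; set q := x + s + d.
pose K := Num.truncn (L / d).
(* Meaningful for [z] in [[0, L]] only. *)
pose cell (z : R) : 'I_K.+1 := inord (Num.truncn (z / d)).
pose inc (k : 'I_K.+1) (z : R) := k%:R * d <= z < k.+1%:R * d.
have inc_trunc z k : 0 <= z -> k%:R * d <= z < k.+1%:R * d ->
    Num.truncn (z / d) = k.
  by move=> z0 kz; apply: truncn_def; rewrite ler_pdivlMr// ltr_pdivrMr.
have cellP z : 0 <= z <= L -> inc (cell z) z.
  move=> /andP[z0 zL]; rewrite /inc /cell inordK.
    have /truncn_itv : 0 <= z / d by apply: divr_ge0 => //; exact: ltW.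
    by rewrite ler_pdivlMr// ltr_pdivrMr.
  by rewrite ltnS; apply: le_truncn; rewrite ler_pM2r ?invr_gt0.
have cell_uniq k z : 0 <= z -> inc k z -> cell z = k.
  by move=> z0 kz; rewrite /cell (inc_trunc z k)// inord_val.
pose C := [set k | `[< exists e, [/\ F e, `|x - e| <= s & inc k e] >]]%SET.
pose S := [set j | (p < l j < q)%R || (p < u j < q)%R]%SET.
pose B := ((fun j => cell (l j)) @: S :|: (fun j => cell (u j)) @: S)%SET.
pose G := (C :\: B)%SET.
have cardB : (#|B| <= 2 * #|S|)%N.
  apply: (leq_trans (leq_card_setU _ _)).
  by rewrite mul2n -addnn leq_add// leq_imset_card.
have kS (k : 'I_K.+1) : k.+1%:R * d = k%:R * d + d :> R.
  by rewrite -natr1 mulrDl mul1r.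
have GP k : k \in G -> [/\ p <= k%:R * d, k.+1%:R * d <= q,
    k.+1%:R * d <= L + d &
    forall j, u j <= k%:R * d \/ k.+1%:R * d <= l j].
  rewrite /G finset.in_setD => /andP[kB]; rewrite inE => /asboolP[e [Fe xe ke]].
  have [e0L eg] := FP _ Fe; move: xe; rewrite ler_norml => xe.
  have := ke; rewrite /inc kS => ke'.
  split; [rewrite /p; lra|rewrite /q; lra|lra|move=> j].
  have [lj0 luj ujL] := lu j.
  have Bin z : z = l j \/ z = u j -> 0 <= z ->
      k%:R * d <= z < k%:R * d + d -> False.
    move=> zj z0 zk; move/negP: kB; apply.
    have jS : j \in S by rewrite inE /p /q; case: zj => <-; apply/orP;
      [left|right]; lra.
    rewrite inE -(cell_uniq k z) ?/inc ?kS//.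
    by case: zj => ->; apply/orP; [left|right]; apply/imsetP; exists j.
  have [elj|uje] := eg j.
    right; rewrite leNgt; apply/negP => H.
    by apply: (Bin (l j)); [left| |]; lra.
  left; rewrite leNgt; apply/negP => H.
  by apply: (Bin (u j)); [right| |]; lra.
have ordcell (k k' : 'I_K.+1) : k != k' ->
    k.+1%:R * d <= k'%:R * d \/ k'.+1%:R * d <= k%:R * d.
  move=> kk'; rewrite !ler_pM2r// !ler_nat.
  by case: ltngtP (kk') => [|//|/val_inj->]; [left|right|rewrite eqxx].
have sumG : \sum_(k in G) (k.+1%:R * d - k%:R * d) = #|G|%:R * d.
  under eq_bigr do rewrite kS addrAC subrr add0r.
  by rewrite sumr_const mulr_natl.
exists #|G|; split.
- rewrite -sumG; have -> : 2 * s + 4 * r = q - p by rewrite /q /p /d; lra.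
  apply: sum_disjoint_itv.
  + by rewrite /p /q; lra.
  + by move=> k /GP[? ? _ _]; split => //; rewrite kS; lra.
  + by move=> k k' _ _; exact: ordcell.
- pose lo (z : 'I_n + 'I_K.+1) :=
    match z with inl j => l j | inr k => k%:R * d end.
  pose hi (z : 'I_n + 'I_K.+1) :=
    match z with inl j => u j | inr k => k.+1%:R * d end.
  pose A : {set 'I_n + 'I_K.+1} :=
    [set z | match z with inl _ => true | inr k => k \in G end]%SET.
  have -> : \sum_(j < n) (u j - l j) + #|G|%:R * d
            = \sum_(z in A) (hi z - lo z).
    rewrite big_sumType/= -sumG; congr (_ + _); last first.
      by apply: eq_bigl => k; rewrite [RHS]inE.
    by apply: eq_bigl => k; rewrite inE.
  have AE k : (inr k \in A) = (k \in G) by rewrite [LHS]inE.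
  rewrite -[leRHS]subr0; apply: sum_disjoint_itv.
  + by rewrite /d; lra.
  + move=> [j|k]; rewrite /lo /hi; first by have [] := lu j; split => //; lra.
    rewrite AE => /GP[_ _ ? _]; split => //; last by rewrite kS; lra.
    by rewrite mulr_ge0// ltW.
  + move=> [j|k] [j'|k'] Az Az'; rewrite /lo /hi.
    * by move=> jj'; exact: ord.
    * by move: Az'; rewrite AE => /GP[_ _ _ /(_ j)].
    * by move: Az; rewrite AE => /GP[_ _ _ /(_ j')[]]; [right|left].
    * by move=> kk'; exact: ordcell.
- apply: (@le_trans _ _ (#|C|%:R)%:E).
    apply: covering_le_cells => // e [/= xe Fe].
    have [e0L _] := FP _ Fe; have ce := cellP _ e0L.
    exists (cell e) => //; rewrite inE; apply/asboolP; exists e; split => //.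
    by move: xe; rewrite closed_ballE.
  rewrite lee_fin ler_nat -(cardsID B C) addnC leq_add2l.
  apply: (leq_trans (subset_leq_card (subsetIr _ _))); apply: (leq_trans cardB).
  by rewrite leq_mul2l card_gaps_with_end_in// => j; have [] := lu j.
Qed.

(** * Comparison of covering numbers *)

(** With [m] the number of large gaps contained in the widened ball, and [g] the
    cells off the large gaps, [m + 1 <= M] and
    [g <= (5 M + 4) / 2], whence [g + 2 (m + 2) <= 9 M] as [1 <= M]. *)
Lemma covering_complementary_le (R : realType) (a : nat -> R) (E : set R)
    (r s x M : R) :
    (forall j, 0 < a j) -> cvgn (series a) -> (forall j, a j.+1 <= a j) ->
    complementary_sets a E -> 0 < r -> r < s ->
    (forall y, decreasing_rearrangement a y ->
      (covering_number r (closed_ball y (6 * s) `&` decreasing_rearrangement a)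
        <= M%:E)%E) ->
  (covering_number r (closed_ball x s `&` E) <= (9 * M)%:E)%E.
Proof.
move=> a0 ca a_dec [_ [l [u [ul sub triv ->]]]] r0 rs HM.
have s0 : 0 < s by lra.
have s60 : 0 < 6 * s by lra.
have lu j : l j < u j by rewrite -subr_gt0 ul.
have L0 : 0 <= total_length a.
  have := tail_sum_ge0 0 a0 ca.
  by rewrite tail_sumE// /series/= big_geq// subr0.
have ex : exists n, a n <= 2 * r.
  have /cvgr0_norm_le/(_ (2 * r))[|n _ /(_ n (leqnn n))] := cvg_series_cvg_0 ca.
    by lra.
  by move=> /(le_trans (ler_norm _)); exists n.
case: (ex_minnP ex) => n an nmin.
have large j : (j < n)%N -> 2 * r < a j.
  by move=> jn; rewrite ltNge; apply/negP => /nmin; rewrite leqNgt jn.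
have small j : (n <= j)%N -> a j <= 2 * r.
  by move=> /(nonincreasing_seqP a).1 /le_trans; apply.
have ord (i j : 'I_n) : i != j -> u i <= l j \/ u j <= l i.
  move=> ij; apply: disjoint_itv_ordered => //.
  by move/trivIsetP : triv => /(_ i j I I); apply.
set F := _ `\` _.
have FP e : F e -> 0 <= e <= total_length a /\
    forall j : 'I_n, e <= l j \/ u j <= e.
  rewrite /F /= in_itv/= => -[e0L eU]; split => // j.
  have [|le] := leP e (l j); first by left.
  have [|eu] := leP (u j) e; first by right.
  by exfalso; apply: eU; exists j => //; rewrite /= in_itv/= le.
have lub (j : 'I_n) : [/\ 0 <= l j, l j < u j & u j <= total_length a].
  by have [] := itv_subset_bounds (lu j) (sub j).
have [g [gs gt gcov]] := @covering_off_gaps _ r s x _ _ (fun j => l j)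
  (fun j => u j) F r0 s0 L0 lub ord FP.
apply: (le_trans gcov); rewrite lee_fin.
set S := [set j | _]%SET.
have SM : #|S|%:R + 1 <= M.
  apply: (@large_gaps_le_covering _ a r (6 * s) M n S) => //.
  under eq_bigr do rewrite -ul.
  apply: (@le_trans _ _ ((x + s + 2 * r) - (x - s - 2 * r))); last by lra.
  apply: sum_disjoint_itv; first by lra.
    by move=> j; rewrite inE => /andP[? ?]; split.
  by move=> i j _ _; exact: ord.
(* The cells off the large gaps fill at most [b], up to two cells. *)
pose b := Num.min (tail_sum a n) (2 * s).
have bM : b <= 5 * r * M.
  apply: (@tail_length_le_covering _ a r (6 * s) b M n) => //.
    by rewrite /b le_min ge_min lexx tail_sum_ge0//=; lra.
  by rewrite /b ge_min; apply/orP; right; lra.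
have gb : g%:R * (2 * r) <= b + 4 * r.
  move: gt; under eq_bigr do rewrite ul.
  have := tail_sumE n ca; rewrite /series/= big_mkord /b minEle => ->.
  by case: ifP => _; lra.
have gM : g%:R <= (5 * M + 4) / 2.
  rewrite -(@ler_pM2r _ r)//; lra.
rewrite natrD natrM natrD; have : (0 : R) <= #|S|%:R by []; lra.
Qed.
Unset Implicit Arguments.

Theorem corollary6 (R : realType) (a : nat -> R)
    (a_gt0 : forall j, 0 < a j)
    (a_summable : cvgn (series a))
    (a_decreasing : forall j, a j.+1 <= a j)
    (E : set R) (hE : complementary_sets a E) :
  (assouad_dim E <= assouad_dim (decreasing_rearrangement a))%E.
Proof.
apply: ereal_inf_le_tmp => _ [alpha [c [rho [c0 rho0 HD]]] <-].
exists alpha => //; exists (9 * c * 6 `^ alpha), (rho / 6); split.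
- by rewrite !mulr_gt0// powR_gt0.
- by rewrite divr_gt0.
move=> r s r0 rs srho; apply: ge_ereal_sup => _ [x _ <-].
have r6s : r < 6 * s by lra.
have -> : 9 * c * 6 `^ alpha * (s / r) `^ alpha
          = 9 * (c * (6 * s / r) `^ alpha).
  have sr0 : 0 <= s / r by apply: divr_ge0; lra.
  by rewrite -(mulrA 6 s) (powRM _ (ler0n _ 6) sr0) !mulrA.
apply: (covering_complementary_le x a_gt0) => // y Dy.
have s6rho : 6 * s < rho by lra.
apply: (le_trans _ (HD r (6 * s) r0 r6s s6rho)).
by apply: ereal_sup_ubound; exists y.
Qed.
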